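(* In the $(1:b)$ Maker-Breaker game played on $E(K_n)$, for every bias $b$, Breaker has a strategy that postpones Maker's win (i) in the Perfect Matching game for at least $\frac n2 + \frac b4$ moves (that is, Maker cannot own a perfect matching before he has made at least $\frac n2+\frac b4$ moves), and (ii) in the Hamilton Cycle game for at least $n + \frac b2$ moves (that is, Maker cannot own a Hamilton cycle before he has made at least $n+\frac b2$ moves).
   Context: A $(1:b)$ Maker-Breaker game on the edge set $E(K_n)$: two players, Maker and Breaker, alternately claim previously unclaimed edges, with Breaker going first; in each move Breaker claims $b$ unclaimed edges and Maker claims one unclaimed edge. In the Perfect Matching game Maker's goal is to claim all edges of a perfect matching of $K_n$; in the Hamilton Cycle game Maker's goal is to claim all edges of a Hamilton cycle of $K_n$. *)

(* Defs.v *)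
From mathcomp Require Import all_boot all_order all_algebra.
Set Implicit Arguments.
Unset Strict Implicit.
Unset Printing Implicit Defensive.
Import Order.TTheory GRing.Theory Num.Theory.

Local Open Scope nat_scope.

Section Game.

(* [X] is the board, [b] the bias of Breaker, who moves first. *)
Variables (T : finType) (X : {set T}) (b : nat).

(* A history is the list of the completed rounds, oldest first: in each round
   Breaker claims a set of elements and then Maker claims one element. *)
Definition history : Type := seq ({set T} * T).

Definition breaker_claimed (h : history) : {set T} :=
  [set x | has (fun r : {set T} * T => x \in r.1) h].

Definition maker_claimed (h : history) : {set T} :=
  [set x | x \in [seq r.2 | r <- h]].

Definition unclaimed (h : history) : {set T} :=
  X :\: (breaker_claimed h :|: maker_claimed h).

Definition breaker_strategy : Type := history -> {set T}.

Inductive play (s : breaker_strategy) : history -> Prop :=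
| play_start : play s [::]
| play_round h x :
    play s h -> x \in unclaimed h :\: s h -> play s (rcons h (s h, x)).

(* Breaker must claim exactly [b] unclaimed elements, or all of them when fewer
   than [b] remain. *)
Definition legal_strategy (s : breaker_strategy) : Prop :=
  forall h, play s h ->
    s h \subset unclaimed h /\ #|s h| = minn b #|unclaimed h|.

Variable F : {set T} -> Prop.

Definition maker_owns (h : history) : Prop :=
  exists2 W : {set T}, F W & W \subset maker_claimed h.

(* [size h] is the number of moves that Maker has made in [h]. Play is not
   stopped when Maker first wins; the condition at the first win implies the
   condition at all later points. *)
Definition breaker_postpones (t : rat) : Prop :=
  exists s : breaker_strategy, legal_strategy s /\
    forall h, play s h -> maker_owns h -> (t <= (size h)%:R)%R.

End Game.

Definition complete_edges (n : nat) : {set {set 'I_n}} :=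
  [set e : {set 'I_n} | #|e| == 2].

Definition perfect_matching (n : nat) (P : {set {set 'I_n}}) : Prop :=
  P \subset complete_edges n /\
  forall v : 'I_n, #|[set e in P | v \in e]| = 1.

Definition hamilton_cycle (n : nat) (H : {set {set 'I_n}}) : Prop :=
  exists c : seq 'I_n,
    [/\ 2 < size c, uniq c, forall v, v \in c
      & H = [set [set v; next c v] | v : 'I_n]].

(* Main.v *)
(* Both goals force minimum degree r in Maker's graph, with r = 1 for a perfect
   matching and r = 2 for a Hamilton cycle.  Write def v = max(0, r - deg v) and
   w D for the sum of def over D, and call D closed if no unclaimed edge lies
   inside D.  A Maker move lowers w D by at most 1 when D is closed, so Maker
   still needs w D moves; if moreover all deficient vertices lie in D, then
   counting degrees gives 2 M >= r n - w D for the number M of moves made, and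
   Maker needs M + w D >= (r n + w D) / 2 moves in all.  So Breaker wants a
   closed D containing all deficient vertices, with w D >= r b / 2.
   Breaker first lets a closed set C of Maker-isolated vertices grow by two
   vertices per move, at cost 2 |C| + 1 <= b, while Maker removes at most one of
   them.  If the isolated vertices outside C run out too early, then
   n <= 3 |C| + 1, and Breaker claims all remaining edges at a vertex of C, at
   most n - |C| <= 2 |C| + 1 <= b of them.  Otherwise |C| >= b / 2 is reached,
   and afterwards adding one deficient vertex per move (affordable while
   |D| <= b; when |D| > b there is slack as w D >= |D| and r <= 2) makes up for
   Maker's move, until no deficient vertex is left outside D. *)
Require Import Defs.
From mathcomp Require Import all_boot all_order all_algebra.
From mathcomp Require Import zify lra.
Import Order.TTheory GRing.Theory Num.Theory.

Section Strategy.

Set Implicit Arguments.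
Unset Strict Implicit.
Unset Printing Implicit Defensive.

Local Open Scope nat_scope.

(** * From a one-round invariant to a legal Breaker strategy *)

Lemma subset_pad (T : finType) (A U : {set T}) (b : nat) :
  A \subset U -> #|A| <= b ->
  exists B : {set T}, [/\ A \subset B, B \subset U & #|B| = minn b #|U|].
Proof.
move=> sAU; move En: (minn b #|U| - #|A|) => n; elim: n A sAU En => [|n IHn] A sAU En leAb.
  by exists A; split=> //; have := subset_leq_card sAU; lia.
have /properP[_ [x xU xA]] : A \proper U.
  by rewrite properEcard sAU; lia.
have cardA : #|x |: A| = #|A|.+1 by rewrite cardsU1 xA.
have [||| B [sAB sBU cB]] := IHn (x |: A).
- by rewrite subUset sub1set xU.
- by rewrite cardA; lia.
- by rewrite cardA; lia.
exists B; split=> //; exact: subset_trans (subsetUr _ _) sAB.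
Qed.

(** Legality fixes how many elements Breaker claims, so the set [B] that he wants is padded by
    [subset_pad]; hence the invariant has to survive every superset [B']. *)
Lemma postpones_of_invariant (T : finType) (X : {set T}) (b : nat)
    (F : {set T} -> Prop) (t : rat) (Inv : pred (history T)) :
  Inv [::] ->
  (forall h, Inv h -> exists B : {set T},
     [/\ B \subset unclaimed X h, #|B| <= b
       & forall (B' : {set T}) x, B \subset B' -> x \in unclaimed X h :\: B' ->
           Inv (rcons h (B', x))]) ->
  (forall h, Inv h -> maker_owns F h -> (t <= (size h)%:R)%R) ->
  breaker_postpones X b F t.
Proof.
move=> Inv0 InvS Invt.
pose good h (B : {set T}) := [&& B \subset unclaimed X h,
  #|B| == minn b #|unclaimed X h|
  & [forall x in unclaimed X h :\: B, Inv (rcons h (B, x))]].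
(* The default [set0] can only be reached where [Inv] fails. *)
pose s h := odflt set0 [pick B | good h B].
have sP h : Inv h -> good h (s h).
  move=> /InvS[B [sBU leBb InvB]]; rewrite /s; case: pickP => //= no.
  have [B' [sBB' sB'U cB']] := subset_pad sBU leBb.
  have /negP[] := negbT (no B').
  rewrite /good sB'U cB' eqxx; apply/forallP=> x; apply/implyP; exact: InvB.
have playI h : play X s h -> Inv h.
  elim=> // {}h x _ Ih xU; have /and3P[_ _ /forallP/(_ x)] := sP h Ih.
  by rewrite xU.
exists s; split=> [h /playI/sP/and3P[-> /eqP ->] //|h /playI]; exact: Invt.
Qed.

Lemma unclaimed_rcons (T : finType) (X : {set T}) (h : history T) B x :
  unclaimed X (rcons h (B, x)) \subset (unclaimed X h :\: B) :\ x.
Proof.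
apply/subsetP=> y; rewrite !inE !has_rcons map_rcons mem_rcons inE /=.
by rewrite !negb_or -!andbA; case/and5P=> -> -> -> -> ->.
Qed.

Section MinDegree.

Variables (V : finType) (r b : nat).
Hypotheses (r_gt0 : 0 < r) (r_le2 : r <= 2).

Implicit Types (U B : {set {set V}}) (C D : {set V}) (h : history {set V}).

Let X : {set {set V}} := [set e : {set V} | #|e| == 2].

(** * Closed vertex sets and the cost of enlarging them *)

Definition closed_in U D := [forall e : {set V} in U, #|e :&: D| <= 1].

Lemma closed_inP U D :
  reflect (forall e, e \in U -> #|e :&: D| <= 1) (closed_in U D).
Proof. exact: forall_inP. Qed.

Lemma closed_inS U U' D D' :
  U' \subset U -> D' \subset D -> closed_in U D -> closed_in U' D'.
Proof.
move=> sU sD /closed_inP cl; apply/closed_inP=> e /(subsetP sU)/cl.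
by apply: leq_trans; apply: subset_leq_card; rewrite setIS.
Qed.

(** As [D] is closed, an unclaimed edge with both ends in [u |: D] joins [u] to a vertex of [D];
    there are at most [#|D|] such edges to claim. *)
Lemma closed_in_add U D u : closed_in U D -> U \subset X ->
  exists B, [/\ B \subset U, #|B| <= #|D| & closed_in (U :\: B) (u |: D)].
Proof.
move=> /closed_inP cl UX.
exists [set e in U | 1 < #|e :&: (u |: D)|]; split.
- by apply/subsetP=> e; rewrite inE => /andP[].
- apply: leq_trans (leq_imset_card (fun v => [set u; v]) D).
  apply/subset_leq_card/subsetP=> e; rewrite inE => /andP[eU].
  have := subsetP UX e eU; rewrite inE => /eqP ce.
  have := cl e eU => clD gt1.
  have /setIidPl sub : e :&: (u |: D) = e.
    by apply/eqP; rewrite eqEcard subsetIl ce.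
  case: (boolP (u \in e)) => ue; last first.
    have sD : e \subset D.
      apply/subsetP=> v ve; have := subsetP sub v ve; rewrite !inE.
      by case: eqP => // eqv; rewrite -eqv ve in ue.
    by move: clD; rewrite (setIidPl sD) ce.
  have /cards1P[v Ev] : #|e :\ u| == 1 by move: ce; rewrite (cardsD1 u) ue; lia.
  have /setD1P[vu ve] : v \in e :\ u by rewrite Ev inE.
  apply/imsetP; exists v; last by rewrite -(setD1K ue) Ev.
  by have := subsetP sub v ve; rewrite !inE (negPf vu).
- apply/closed_inP=> e; rewrite !inE => /andP[+ eU].
  by rewrite eU /= -leqNgt.
Qed.

(** The other end of an edge of [U] at [v] lies outside the closed set [D]. *)
Lemma star_card U D v : closed_in U D -> v \in D -> U \subset X ->
  #|[set e in U | v \in e]| <= #|V| - #|D|.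
Proof.
move=> /closed_inP cl vD UX; have -> : #|V| - #|D| = #|~: D| by have := cardsC D; lia.
apply: leq_trans (leq_imset_card (fun u => [set v; u]) (~: D)).
apply/subset_leq_card/subsetP=> e; rewrite inE => /andP[eU ve].
have := subsetP UX e eU; rewrite inE => /eqP ce.
have /cards1P[u Eu] : #|e :\ v| == 1 by move: ce; rewrite (cardsD1 v) ve; lia.
have /setD1P[uv ue] : u \in e :\ v by rewrite Eu inE.
apply/imsetP; exists u; last by rewrite -(setD1K ve) Eu.
rewrite inE; apply/negP=> uD; have := cl e eU.
suff : #|[set v; u]| <= #|e :&: D| by rewrite cards2 eq_sym uv; lia.
by apply/subset_leq_card; rewrite subUset !sub1set !inE ve vD ue uD.
Qed.

(** * Degrees, deficits and weights *)

(* Counting rounds rather than edges makes the degree sum exactly twice the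
   number of Maker's moves. *)
Definition deg h v := count (fun p : {set {set V}} * {set V} => v \in p.2) h.
Definition deficit h v := r - deg h v.
Definition weight h D := \sum_(v in D) deficit h v.
Definition isolated h : {set V} := [set v | deg h v == 0].
Definition deficient h : {set V} := [set v | 0 < deficit h v].

Lemma deg_rcons h B x v : deg (rcons h (B, x)) v = deg h v + (v \in x).
Proof. by rewrite /deg -cats1 count_cat /= addn0. Qed.

Lemma sum_deg h : {in [seq p.2 | p <- h], forall e : {set V}, #|e| = 2} ->
  \sum_v deg h v = (size h).*2.
Proof.
elim/last_ind: h => [|h [B x] IHh] hX; first by rewrite big1.
rewrite (eq_bigr (fun v => deg h v + (v \in x))) => [|v _]; last exact: deg_rcons.
rewrite big_split /= IHh => [|e eh]; last first.
  by apply: hX; rewrite map_rcons mem_rcons inE eh orbT.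
rewrite -big_mkcond sum1_card hX ?size_rcons; first by rewrite doubleS addn2.
by rewrite map_rcons mem_rcons inE eqxx.
Qed.

Lemma weight_rcons h B (x : {set V}) D : #|x :&: D| <= 1 ->
  weight h D <= (weight (rcons h (B, x)) D).+1.
Proof.
move=> le1; rewrite -addn1; apply: leq_trans (leq_add (leqnn _) le1).
have -> : #|x :&: D| = \sum_(v in D) (v \in x).
  rewrite -sum1_card big_mkcond [RHS]big_mkcond; apply: eq_bigr => v _.
  by rewrite inE; case: (v \in x); case: (v \in D).
rewrite /weight -big_split; apply: leq_sum => v _ /=.
by rewrite /deficit deg_rcons; lia.
Qed.

Lemma card_isolated_rcons h B (x : {set V}) : #|x| = 2 ->
  #|isolated h| <= #|isolated (rcons h (B, x))| + 2.
Proof.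
move=> cx; have: isolated h :\: x \subset isolated (rcons h (B, x)).
  apply/subsetP=> v; rewrite !inE deg_rcons => /andP[/negPf-> /eqP->].
  by rewrite addn0.
by move/subset_leq_card; rewrite cardsD; have := subset_leq_card (subsetIr (isolated h) x); lia.
Qed.

Lemma weight_isolated h C : C \subset isolated h -> weight h C = r * #|C|.
Proof.
move=> sC; rewrite mulnC -sum_nat_const; apply: eq_bigr => v /(subsetP sC).
by rewrite inE /deficit => /eqP->; rewrite subn0.
Qed.

(** Lets [D] be trimmed to its deficient vertices after a Maker move without losing weight. *)
Lemma weight_deficient h D : weight h (D :&: deficient h) = weight h D.
Proof.
rewrite /weight big_mkcond [RHS]big_mkcond; apply: eq_bigr => v _.
by rewrite !inE; case: (v \in D) => //=; case: posnP.
Qed.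

Lemma weight_ge_card h D : D \subset deficient h -> #|D| <= weight h D.
Proof.
move=> sD; rewrite -sum1_card; apply: leq_sum => v /(subsetP sD).
by rewrite inE.
Qed.

Lemma weight_ge_total h D : deficient h \subset D ->
  {in [seq p.2 | p <- h], forall e : {set V}, #|e| = 2} ->
  r * #|V| <= 2 * size h + weight h D.
Proof.
move=> sD hX; have := sum_deg hX; rewrite -mul2n => <-.
have -> : weight h D = \sum_v deficit h v.
  rewrite /weight big_mkcond; apply: eq_bigr => v _.
  case: ifP => // /negbT vD; apply/eqP.
  by rewrite eq_sym -leqn0 leqNgt; apply: contra vD => pos; apply: (subsetP sD); rewrite inE.
rewrite -big_split mulnC -sum_nat_const; apply: leq_sum => v _ /=.
by rewrite /deficit; lia.
Qed.

(** * States of the strategy *)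

Definition killed h :=
  [exists v in deficient h, [forall e : {set V} in unclaimed X h, v \notin e]].

(** The last bound records the pace: per round Maker's edge removes at most two isolated vertices,
    while [C] gains at least one vertex. *)
Definition growing h := [exists C : {set V},
  [&& closed_in (unclaimed X h) C, C \subset isolated h, 2 * #|C| < b
    & #|V| <= #|isolated h| + 2 * #|C| ]].

Definition holding h := [exists D : {set V},
  [&& closed_in (unclaimed X h) D, D \subset deficient h
    & r * b <= 2 * weight h D]].

(** The target [r n / 2 + r b / 4] cleared of denominators. No Maker move decreases
    [size h + weight h D] for closed [D], so this state persists whatever Breaker claims. *)
Definition final h := [exists D : {set V},
  closed_in (unclaimed X h) D &&
  (2 * (r * #|V|) + r * b <= 4 * (size h + weight h D))].

Definition edges_only h := all (fun p : {set {set V}} * {set V} => #|p.2| == 2) h.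

Definition invariant h :=
  edges_only h && [|| killed h, growing h, holding h | final h].

Lemma edges_onlyP h : edges_only h ->
  {in [seq p.2 | p <- h], forall e : {set V}, #|e| = 2}.
Proof. by move=> /allP hX e /mapP[p /hX /eqP ep ->]. Qed.

(** The step premise of [postpones_of_invariant], with a state [P] as the goal of the round. *)
Definition next_state (P : pred (history {set V})) h :=
  exists B, [/\ B \subset unclaimed X h, #|B| <= b
    & forall (B' : {set {set V}}) (x : {set V}), B \subset B' -> x \in unclaimed X h :\: B' ->
        P (rcons h (B', x))].

Lemma next_stateS (P Q : pred (history {set V})) h :
  (forall h, P h -> Q h) -> next_state P h -> next_state Q h.
Proof.
by move=> PQ [B [sBU leBb BP]]; exists B; split=> // B' x sB /BP; auto.
Qed.

Lemma unclaimed_sub h : unclaimed X h \subset X.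
Proof. exact: subsetDl. Qed.

Lemma round_facts h (B B' : {set {set V}}) (x : {set V}) : B \subset B' -> x \in unclaimed X h :\: B' ->
  [/\ x \in unclaimed X h :\: B, #|x| = 2
    & unclaimed X (rcons h (B', x)) \subset unclaimed X h :\: B].
Proof.
move=> sB xU; have xU' := subsetP (setDS _ sB) x xU; split=> //.
  have /setDP[xU2 _] := xU; have := subsetP (unclaimed_sub h) x xU2.
  by rewrite inE => /eqP.
apply: subset_trans (unclaimed_rcons _ _ _ _) _.
exact: subset_trans (subD1set _ _) (setDS _ sB).
Qed.

(** * One round from each state *)

Lemma kill_state h v : v \in deficient h ->
  #|[set e in unclaimed X h | v \in e]| <= b -> next_state killed h.
Proof.
move=> vd leb; exists [set e in unclaimed X h | v \in e]; split=> //.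
  by apply/subsetP=> e; rewrite inE => /andP[].
move=> B' x sB /(round_facts sB)[xU _ sU].
apply/existsP; exists v; apply/andP; split; last first.
  apply/forall_inP=> e /(subsetP sU); rewrite !inE.
  by case: (v \in e); rewrite // andbT => /andP[/negbTE->].
move: xU vd; rewrite !inE /deficit deg_rcons.
by case: (v \in x); rewrite ?addn0 // andbT => /andP[/negbTE->].
Qed.

Lemma final_step h : final h -> next_state final h.
Proof.
case/existsP=> D /andP[cl bound]; exists set0; rewrite sub0set cards0; split=> //.
move=> B' x sB /(round_facts sB)[xU _ sU].
apply/existsP; exists D; rewrite size_rcons; apply/andP; split.
  by apply: closed_inS cl => //; rewrite setD0 in sU.
have := @weight_rcons h B' x D.
rewrite setD0 in xU; move/closed_inP: cl => /(_ x xU) le1 /(_ le1); lia.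
Qed.

Lemma holding_final h D : edges_only h -> closed_in (unclaimed X h) D ->
  deficient h \subset D -> r * b <= 2 * weight h D -> final h.
Proof.
move=> hX cl sD hold; apply/existsP; exists D; rewrite cl /=.
have arith s w rb rV : rb <= 2 * w -> rV <= 2 * s + w ->
  2 * rV + rb <= 4 * (s + w) by lia.
exact: arith hold (weight_ge_total sD (edges_onlyP hX)).
Qed.

(** The surplus of 2 in the doubled weight pays for Maker's next move. *)
Lemma hold_state h B D : B \subset unclaimed X h -> #|B| <= b ->
  closed_in (unclaimed X h :\: B) D -> r * b + 2 <= 2 * weight h D ->
  next_state holding h.
Proof.
move=> sBU leBb cl bound; exists B; split=> // B' x sB /(round_facts sB)[xU _ sU].
apply/existsP; exists (D :&: deficient (rcons h (B', x))).
rewrite subsetIr weight_deficient /=; apply/andP; split.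
  by apply: closed_inS cl => //; apply: subsetIl.
set w' := weight _ D; have : weight h D <= w'.+1; last by lia.
by apply: weight_rcons; move/closed_inP: cl; apply.
Qed.

Lemma holding_step h : edges_only h -> holding h ->
  next_state holding h \/ next_state final h.
Proof.
move=> hX /existsP[D /and3P[cl sD bound]].
have [sub|/subsetPn[u ud uD]] := boolP (deficient h \subset D).
  by right; apply: final_step; apply: holding_final bound.
left; have [leDb|ltbD] := leqP #|D| b.
  have [B [sBU leB clB]] := closed_in_add u cl (unclaimed_sub h).
  apply: (hold_state sBU (leq_trans leB leDb) clB).
  (* The deficient vertex [u] adds at least 1 to the weight, which is the surplus needed. *)
  rewrite /weight big_setU1 // -/(weight h D).
  by move: ud; rewrite inE /=; lia.
(* Here nothing need be claimed: [2 * weight h D >= 2 * #|D| >= 2 * b + 2 >= r * b + 2]. *)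
apply: (@hold_state h set0 D); rewrite ?sub0set ?cards0 ?setD0 //.
have := weight_ge_card sD; have := leq_mul2r b r 2; rewrite r_le2 orbT; lia.
Qed.

Lemma growing_step h : 0 < #|V| -> growing h ->
  next_state killed h \/ next_state [pred h | growing h || holding h] h.
Proof.
move=> V0 /existsP[C /and4P[cl sC ltC bound]].
have UX := unclaimed_sub h.
have cI := cardsDS sC.
have [few|many] := leqP #|isolated h :\: C| 1.
  left; have leb : #|V| - #|C| <= b by lia.
  have [C0|[v vC]] := set_0Vmem C; last first.
    apply: (@kill_state h v); last exact: leq_trans (star_card cl vC UX) leb.
    by have := subsetP sC v vC; rewrite !inE /deficit => /eqP->; rewrite subn0.
  (* With [C] empty the bounds force [#|V| = 1], so the board has no edges and the single vertex is
     dead for free. *)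
  have /card_gt0P[v vI] : 0 < #|isolated h| by move: bound V0; rewrite C0 cards0; lia.
  apply: (@kill_state h v).
    by move: vI; rewrite !inE /deficit => /eqP->; rewrite subn0.
  have -> : [set e in unclaimed X h | v \in e] = set0; last by rewrite cards0.
  apply/setP=> e; rewrite [LHS]inE in_set0; apply/negP=> /andP[eU _].
  have := subsetP UX e eU; rewrite inE => /eqP ce.
  have leV : #|e| <= #|V| by apply: max_card.
  by move: cI few bound; rewrite C0 cards0; lia.
right; have /card_gt1P[u [v [/setDP[uI uC] /setDP[vI vC] uv]]] := many.
have [B1 [sB1 leB1 cl1]] := closed_in_add u cl UX.
have [B2 [sB2 leB2 cl2]] := closed_in_add v cl1 (subset_trans (subsetDl _ _) UX).
have cC1 : #|u |: C| = #|C|.+1 by rewrite cardsU1 uC.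
have vC1 : v \notin u |: C by rewrite !inE negb_or eq_sym uv.
have cC2 : #|v |: (u |: C)| = #|C|.+2 by rewrite cardsU1 vC1 cC1.
exists (B1 :|: B2); split.
- by rewrite subUset sB1 (subset_trans sB2 (subsetDl _ _)).
- rewrite (leq_trans (leq_card_setU B1 B2)) // (leq_trans (leq_add leB1 leB2)) //.
  by rewrite cC1 addnS addnn -mul2n.
move=> B' x sB /(round_facts sB)[xU cx sU].
rewrite -setDDl in xU sU.
(* Dropping the ends of Maker's edge keeps [C'] isolated; closedness means that at most one of the
   two new vertices' worth of growth is lost. *)
set h' := rcons _ _; set C' := (v |: (u |: C)) :\: x.
have cC' : #|C| < #|C'|.
  have /closed_inP/(_ x xU) := cl2.
  by rewrite /C' cardsD cC2 setIC ltn_subRL -addn2 addnC ltn_add2l ltnS.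
have clC' : closed_in (unclaimed X h') C'.
  by apply: closed_inS cl2 => //; apply: subsetDl.
have sC' : C' \subset isolated h'.
  apply/subsetP=> w /setDP[wC wx]; rewrite inE deg_rcons (negPf wx) addn0.
  suff: w \in isolated h by rewrite inE.
  by move: wC; rewrite !in_setU1 => /or3P[/eqP->|/eqP->|/(subsetP sC)].
have leI := card_isolated_rcons h B' cx; rewrite -/h' in leI.
apply/orP; have [lt|le] := ltnP (2 * #|C'|) b.
  left; apply/existsP; exists C'; rewrite clC' sC' lt /=.
    apply: leq_trans bound (leq_trans (leq_add leI (leqnn _)) _).
    by rewrite -addnA leq_add2l -mulnS leq_mul2l.
right; apply/existsP; exists C'; rewrite clC' (weight_isolated sC') /=.
apply/andP; split; last by rewrite mulnCA leq_mul2l le orbT.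
by apply: subset_trans sC' _; apply/subsetP=> w; rewrite !inE /deficit => /eqP->; rewrite subn0.
Qed.

Lemma killed_step h : killed h -> next_state killed h.
Proof.
case/existsP=> v /andP[vd /forall_inP noe]; apply: (kill_state vd).
rewrite (_ : finset _ = set0) ?cards0 //; apply/setP=> e; rewrite [LHS]inE in_set0.
by apply/negP=> /andP[/noe/negbTE->].
Qed.

Lemma invariant_step h : 0 < #|V| -> invariant h -> next_state invariant h.
Proof.
move=> V0 /andP[hX state].
suff [B [sBU leBb BI]] : next_state
    [pred h | [|| killed h, growing h, holding h | final h]] h.
  exists B; split=> // B' x sB xU; apply/andP; split; last exact: BI.
  have [_ cx _] := round_facts sB xU.
  by rewrite /edges_only all_rcons /= cx eqxx.
have weaken (P : pred _) : (forall h, P h -> [|| killed h, growing h, holding h | final h]) ->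
  next_state P h -> _ := @next_stateS P _ h.
case/or4P: state => [kill|grow|hold|fin].
- by apply: weaken (killed_step kill) => h' /= ->.
- have [] := growing_step V0 grow; apply: weaken => h' /=; first by move->.
  by case/orP=> ->; rewrite ?orbT.
- by have [] := holding_step hX hold; apply: weaken => h' /= ->; rewrite ?orbT //.
- by apply: weaken (final_step fin) => h' /= ->; rewrite ?orbT.
Qed.

(** * The start of the game and the bound at Maker's win *)

Lemma invariant_start : invariant [::].
Proof.
rewrite /invariant /=; have cl U : closed_in U set0.
  by apply/closed_inP=> e _; rewrite setI0 cards0.
(* For [b = 0] the strict bound in [growing] fails, but the empty set is already [holding]. *)
case: (posnP b) => [b0|b_gt0]; apply/or4P.
  by apply: Or43; apply/existsP; exists set0; rewrite cl sub0set b0 muln0.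
apply: Or42; apply/existsP; exists set0; rewrite cl sub0set cards0 b_gt0 addn0 /=.
by apply/subset_leq_card/subsetP=> v _; rewrite inE.
Qed.

(** Once no vertex is deficient, [killed] and [growing] are impossible, [holding] implies [final],
    and all weights in [final] vanish. *)
Lemma invariant_win h : 0 < #|V| -> invariant h -> (forall v, r <= deg h v) ->
  2 * (r * #|V|) + r * b <= 4 * size h.
Proof.
move=> V0 /andP[hX state] win.
have no_def v : deficit h v = 0 by apply/eqP; rewrite subn_eq0.
have w0 D : weight h D = 0 by rewrite /weight big1.
have d0 : deficient h = set0 by apply/setP=> v; rewrite !inE no_def.
suff : final h by case/existsP=> D /andP[_]; rewrite w0 addn0.
case/or4P: state => //.
- by case/existsP=> v; rewrite d0 inE.
- have I0 : isolated h = set0.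
    by apply/setP=> v; rewrite !inE; have := win v; case: (deg h v) => //; lia.
  by case/existsP=> C /and4P[_]; rewrite I0 subset0 => /eqP-> _; rewrite !cards0; lia.
- case/existsP=> D /and3P[cl _ bound].
  by apply: holding_final bound; rewrite // d0 sub0set.
Qed.

Lemma min_degree_postponed (F : {set {set V}} -> Prop) : 0 < #|V| ->
  (forall W v, F W -> r <= #|[set e in W | v \in e]|) ->
  breaker_postpones X b F
    ((r * #|V|)%:R / 2%:R + (r * b)%:R / 4%:R)%R.
Proof.
move=> V0 degF; apply: (@postpones_of_invariant _ _ _ _ _ invariant).
- exact: invariant_start.
- by move=> h; apply: invariant_step.
move=> h Ih [W FW sW].
have win v : r <= deg h v.
  apply: leq_trans (degF W v FW) _.
  rewrite /deg -(count_map snd (fun e : {set V} => v \in e)) -size_filter.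
  apply: leq_trans (card_size _); apply/subset_leq_card/subsetP=> e.
  rewrite !inE mem_filter => /andP[/(subsetP sW)]; rewrite inE => -> ->.
  by [].
have := invariant_win V0 Ih win; rewrite -(ler_nat rat) natrD !natrM; lra.
Qed.

End MinDegree.

(** * Hamilton cycles and the two games *)

Lemma hamilton_cycle_degree n (H : {set {set 'I_n}}) v :
  hamilton_cycle H -> 2 <= #|[set e in H | v \in e]|.
Proof.
case=> c [sc uc /(_ v) vc ->].
(* Rotating [v] to the front lets [next] compute. *)
have [i c' Ec] := rot_to vc.
have nextE u : next c u = next (v :: c') u by rewrite -Ec next_rot.
have uc' : uniq (v :: c') by rewrite -Ec rot_uniq.
have := sc; rewrite -(size_rot i) Ec; case: c' {Ec} nextE uc' => [|a [|d s]] // nextE uc' _.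
set p := prev c v.
have nv : next c v = a by rewrite nextE /= eqxx.
have np : next c p = v by rewrite /p next_prev.
have [av dv] : a != v /\ d != v.
  by move: uc'; rewrite /= !inE !negb_or => /andP[/and3P[va vd _] _]; rewrite eq_sym va eq_sym vd.
(* The successor of [a] is [d], not [v], while that of [p] is [v]; this is where a third vertex is
   needed. *)
have ap : a != p.
  apply: contra dv => /eqP ap; rewrite -np -ap nextE /=.
  by rewrite eq_sym (negPf av) eqxx.
have ne : [set v; a] != [set p; v].
  apply/negP=> /eqP/setP/(_ a); rewrite !inE eqxx orbT (negPf ap) (negPf av).
  by [].
have <- : #|[set [set v; a]; [set p; v]]| = 2 by rewrite cards2 ne.
apply/subset_leq_card/subsetP=> e; rewrite !inE => /orP[]/eqP->.
  by rewrite !inE eqxx andbT; apply/imsetP; exists v; rewrite ?nv.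
by rewrite !inE eqxx orbT andbT; apply/imsetP; exists p; rewrite ?np.
Qed.

End Strategy.

Theorem theorem1p5 (n b : nat) (hn : (0 < n)%N) :
  breaker_postpones (complete_edges n) b (@perfect_matching n)
    (n%:R / 2%:R + b%:R / 4%:R)%R
  /\
  breaker_postpones (complete_edges n) b (@hamilton_cycle n)
    (n%:R + b%:R / 2%:R)%R.
Proof.
have V0 : (0 < #|'I_n|)%N by rewrite card_ord.
split.
  have deg1 W v : @perfect_matching n W -> (1 <= #|[set e in W | v \in e]|)%N.
    by case=> _ ->.
  have := @min_degree_postponed _ 1 b isT isT _ V0 deg1.
  by rewrite !mul1n card_ord.
have := @min_degree_postponed _ 2 b isT isT _ V0 (@hamilton_cycle_degree n).
rewrite card_ord !natrM.
by have -> : (2%:R * n%:R / 2%:R + 2%:R * b%:R / 4%:R = n%:R + b%:R / 2%:R :> rat)%R by lra.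
Qed.
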